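(* Let $L$ be a nice Laurent polynomial in $D$ variables, $m=\ell(L)$, $k\ge1$, and let $\mathcal N_{k,m}=\{p_1,\dots,p_{r_{k,m}}\}\subset Z(L)$ be a set of nodes. Then the Laurent–Vandermonde matrix $\mathcal V_k^m$ has full column rank if and only if $$(L)_{k+m-1}=\big(\operatorname{Im}\mathcal V_k^m\big)^\perp ,$$ where $(\operatorname{Im}\mathcal V_k^m)^\perp$ is identified with the space of Laurent polynomials of longitude less than $k+m$ vanishing at all the nodes.
   Context: For $\alpha\in\mathbb{Z}^D$ let $|\alpha|=\sum_a|\alpha_a|$, $z^\alpha=\prod_az_a^{\alpha_a}$, $[k]=\{\alpha:|\alpha|=k\}$, $|[k]|$ its cardinality and $N_k=\sum_{l=0}^k|[l]|$. The longitude of a nonzero Laurent polynomial $L=\sum L_\alpha z^\alpha$ is $\ell(L)=\max\{|\alpha|:L_\alpha\neq0\}$ (the zero polynomial counts as having longitude less than any bound), and $Z(L)=\{p\in(\mathbb{C}^* )^D:L(p)=0\}$. $L$ is nice if $\ell(LM)=\ell(L)+\ell(M)$ for every nonzero Laurent polynomial $M$. Let $r_{k,m}=|[k]|+\cdots+|[k+m-1]|=N_{k+m-1}-N_{k-1}$. Let $\chi^{[k+m]}(z)\in\mathbb{C}^{N_{k+m-1}}$ be the column vector of all monomials $z^\alpha$ with $|\alpha|<k+m$ (ordered by longitude, then lexicographically). The Laurent–Vandermonde matrix is $\mathcal V_k^m=\big(\chi^{[k+m]}(p_1),\dots,\chi^{[k+m]}(p_{r_{k,m}})\big)\in\mathbb{C}^{N_{k+m-1}\times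 r_{k,m}}$. $(\operatorname{Im}\mathcal V_k^m)^\perp=\{v\in\mathbb{C}^{N_{k+m-1}}:v^\dagger\mathcal V_k^m=0\}$, and $v=(v_\alpha)$ in it is identified with the Laurent polynomial $\sum_{|\alpha|<k+m}\overline{v_\alpha}z^\alpha$. The truncated principal ideal $(L)_{k+m-1}$ is the complex linear span of $\{z^\alpha L(z):\alpha\in\mathbb{Z}^D,\ \ell(z^\alpha L)<k+m\}$. *)

(* Defs.v *)
From HB Require Import structures.
From mathcomp Require Import all_boot all_order all_algebra.
From mathcomp Require Import finmap.
From mathcomp Require Import zify complex.
From mathcomp.multinomials Require Import monalg.
From mathcomp Require Import classical_sets reals.

Set Implicit Arguments.
Unset Strict Implicit.
Unset Printing Implicit Defensive.

Import Order.TTheory GRing.Theory Num.Theory.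

Local Open Scope classical_set_scope.
Local Open Scope ring_scope.
Local Open Scope complex_scope.
Local Open Scope sesquilinear_scope.

Definition explen D (a : 'rV[int]_D) : nat := (\sum_(i < D) `|a ord0 i|)%N.

Definition lexle D : rel 'rV[int]_D := fun a b =>
  (([tuple a ord0 i | i < D] : D.-tuplelexi int)
     <= ([tuple b ord0 i | i < D] : D.-tuplelexi int))%O.

Definition box D (k : nat) : seq 'rV[int]_D :=
  [seq map_mx (fun i : 'I_(k.*2.+1) => (i : nat)%:Z - k%:Z) t
     | t : 'rV['I_(k.*2.+1)]_D].

(* [k], as a lexicographically sorted sequence (see mem_layer, layer_uniq). *)
Definition layer D (k : nat) : seq 'rV[int]_D :=
  sort (@lexle D) [seq a <- box D k | explen a == k].

(* All exponents of length < n, by length and then lexicographically. *)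
Definition expos D (n : nat) : seq 'rV[int]_D :=
  flatten [seq layer D l | l <- iota 0 n].

Definition nlayer D (k : nat) : nat := size (layer D k).

(* Number of exponents of length < n, i.e. N_{n-1} (with N_{-1} = 0). *)
Definition nexpos D (n : nat) : nat := (\sum_(0 <= l < n) nlayer D l)%N.

Definition nnodes D (k m : nat) : nat := (\sum_(k <= l < k + m) nlayer D l)%N.

Lemma mem_layer D k (a : 'rV[int]_D) : (a \in layer D k) = (explen a == k).
Proof.
rewrite mem_sort mem_filter; have [eq_a|] //= := eqVneq.
have lea i : (`|a ord0 i| <= k)%N by rewrite -eq_a /explen (bigD1 i) //= leq_addr.
have in0 i : 0 <= a ord0 i + k%:Z by have := lea i; lia.
have in1 i : (`|(a ord0 i + k%:Z)%R| < k.*2.+1)%N by have := lea i; lia.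
rewrite /box; apply/mapP; exists (\row_i Ordinal (in1 i)); first exact: mem_enum.
by apply/rowP => i; rewrite !mxE /= gez0_abs // addrK.
Qed.

Lemma layer_uniq D k : uniq (layer D k).
Proof.
rewrite sort_uniq filter_uniq // map_inj_uniq ?enum_uniq // => s t /rowP eq_st.
apply/rowP => i; apply: val_inj; move/(_ i): eq_st; rewrite !mxE.
by move/addIr => [].
Qed.

Lemma mem_expos D n (a : 'rV[int]_D) : (a \in expos D n) = (explen a < n)%N.
Proof.
apply/flatten_mapP/idP => [[l]|lt_an].
  by rewrite mem_iota mem_layer => /= ltn /eqP ->.
by exists (explen a); rewrite ?mem_iota ?mem_layer.
Qed.

Lemma expos_uniq D n : uniq (expos D n).
Proof.
rewrite /expos; elim: n => // n IHn.
have -> : iota 0 n.+1 = iota 0 n ++ [:: n] by rewrite -addn1 iotaD.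
rewrite map_cat flatten_cat cat_uniq IHn /= cats0 layer_uniq andbT.
apply/hasPn => a; rewrite mem_layer => /eqP eq_an.
by rewrite -/(expos D n) mem_expos eq_an ltnn.
Qed.

Lemma size_expos D n : size (expos D n) = nexpos D n.
Proof.
by rewrite /expos size_flatten /shape -map_comp sumnE big_map /nexpos /index_iota subn0.
Qed.

(* The group algebra of Z^D: monalg only provides its module structure, the
   exponents not forming a monomType, whence lmul below. *)
Notation laurent R D := {malg R[i]['rV[int]_D]}.

Section Laurent.
Variables (R : realType) (D : nat).
Implicit Types (L M : laurent R D) (p : 'rV[R[i]]_D) (n : nat).

Definition lmul L M : laurent R D :=
  \sum_(a <- msupp L) \sum_(b <- msupp M) << L@_a * M@_b *g (a + b)%R >>.

(* The longitude of 0 is set to 0; longitude_lt handles 0 separately. *)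
Definition longitude L : nat := (\max_(a <- msupp L) explen a)%N.

Definition longitude_lt L n : bool := (L == 0) || (longitude L < n)%N.

Definition nice L : Prop :=
  L != 0 /\
  forall M, M != 0 -> longitude (lmul L M) = (longitude L + longitude M)%N.

Definition monval p (a : 'rV[int]_D) : R[i] := \prod_(i < D) p ord0 i ^ a ord0 i.

Definition leval L p : R[i] := mmap idfun (monval p) L.

Definition zeros L : set 'rV[R[i]]_D :=
  [set p : 'rV[R[i]]_D | (forall i, p ord0 i != 0) /\ leval L p = 0].

Definition expo n (i : 'I_(nexpos D n)) : 'rV[int]_D := nth 0 (expos D n) i.

(* chi^{[n]} *)
Definition chi n p : 'cV[R[i]]_(nexpos D n) := \col_i monval p (expo i).

Definition laurent_vandermonde n r (p : 'I_r -> 'rV[R[i]]_D) :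
    'M[R[i]]_(nexpos D n, r) :=
  \matrix_(i, j) chi n (p j) i ord0.

Definition orth_im n r (V : 'M[R[i]]_(n, r)) : set 'cV[R[i]]_n :=
  [set v | v ^t* *m V = 0].

Definition laurent_of n (v : 'cV[R[i]]_(nexpos D n)) : laurent R D :=
  \sum_i << (Num.conj (v i ord0)) *g expo i >>.

Definition lspan (S : set (laurent R D)) : set (laurent R D) :=
  [set M | exists n (c : 'I_n -> R[i]) (w : 'I_n -> laurent R D),
     (forall i, S (w i)) /\ M = \sum_i c i *: w i].

(* (L)_{n-1} *)
Definition trunc_ideal L n : set (laurent R D) :=
  lspan [set M : laurent R D | longitude_lt M n /\ exists a, M = lmul << a >> L].

(* The identification of the orthogonal complement with the Laurent polynomials
   of longitude < n vanishing at all the nodes. *)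
Lemma orth_im_laurent n r (p : 'I_r -> 'rV[R[i]]_D) :
  [set laurent_of v | v in orth_im (laurent_vandermonde n p)] =
  [set M : laurent R D | longitude_lt M n /\ forall j, leval M (p j) = 0].
Proof.
have evalE (v : 'cV_(nexpos D n)) j :
  leval (laurent_of v) (p j) = (v ^t* *m laurent_vandermonde n p) ord0 j.
  rewrite /leval /laurent_of raddf_sum mxE; apply: eq_bigr => i _.
  by rewrite /= mmapU !mxE.
have lltP M : longitude_lt M n <-> forall a, a \in msupp M -> (explen a < n)%N.
  rewrite /longitude_lt; split=> [/orP[/eqP->|lt_n] a aM|ltM].
  - by rewrite msupp0 inE in aM.
  - by apply: leq_ltn_trans lt_n; rewrite /longitude (bigD1_seq a) //= leq_maxl.
  have [//|M0] := eqVneq M 0; rewrite /= /longitude.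
  have [a aM] : exists a, a \in msupp M.
    by apply/fset0Pn; apply: contra_neq M0 => sM; apply/malgP => a;
       rewrite mcoeff0 mcoeff_outdom // sM.
  case: n ltM {evalE} => [/(_ _ aM)//|n' ltM]; rewrite ltnS.
  by apply/bigmax_leqP_seq => b bM _; rewrite -ltnS ltM.
apply/seteqP; split=> M /=.
  case=> v vV <-; split; last by move=> j; rewrite evalE vV mxE.
  apply/lltP => a; rewrite -mcoeff_neq0 /laurent_of raddf_sum /=.
  apply: contraR; rewrite -mem_expos => aE; rewrite big1 // => i _.
  rewrite mcoeffU; case: eqP => // ea; case/negP: aE.
  by rewrite -ea mem_nth // size_expos.
case=> /lltP ltM M0.
have eqM : laurent_of (\col_(i < nexpos D n) Num.conj M@_(expo i)) = M :> laurent R D.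
  apply/malgP => a; rewrite /laurent_of raddf_sum /=.
  have [aE|aE] := boolP (a \in expos D n).
    have ia : (index a (expos D n) < nexpos D n)%N by rewrite -size_expos index_mem.
    rewrite (bigD1 (Ordinal ia)) //= mcoeffU mxE conjCK /expo nth_index // eqxx.
    rewrite big1 ?addr0 // => j /eqP nj; rewrite mcoeffU; case: eqP => // ea.
    case: nj; apply: val_inj; rewrite /= -ea index_uniq ?expos_uniq //.
    by rewrite size_expos.
  rewrite mcoeff_outdom; last by apply: contra aE => /ltM; rewrite mem_expos.
  rewrite big1 // => i _; rewrite mcoeffU; case: eqP => // ea; case/negP: aE.
  by rewrite -ea mem_nth // size_expos.
exists (\col_(i < nexpos D n) Num.conj M@_(expo i)) => //.
by apply/rowP => j; rewrite -evalE eqM M0 mxE.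
Qed.

End Laurent.

(* Main.v *)
(** By niceness, [z^a L] has longitude [|a| + m] and multiplication by [L] is
    injective, so the truncated ideal has the basis [z^a L] with [|a| < k] and
    hence dimension [N_{k-1}].  It is contained in the space of Laurent
    polynomials of longitude [< k + m] vanishing at the nodes, whose dimension
    is [N_{k+m-1} - rank V].  The two spaces are therefore equal if and only if
    [rank V = N_{k+m-1} - N_{k-1} = r_{k,m}]. *)
Require Import Defs.
From mathcomp Require Import all_boot all_order all_algebra.
From mathcomp Require Import finmap.
From mathcomp Require Import complex.
From mathcomp.multinomials Require Import monalg.
From mathcomp Require Import classical_sets reals.

Import GRing.Theory.

Local Open Scope classical_set_scope.
Local Open Scope ring_scope.
Local Open Scope complex_scope.

(** * Exponents and longitude bounds *)

Lemma explen_eq0 {D} (a : 'rV[int]_D) : (explen a == 0%N) = (a == 0).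
Proof.
rewrite /explen sum_nat_eq0; apply/forallP/eqP => [a0|-> i]; last by rewrite mxE.
by apply/rowP => i; rewrite mxE; apply/eqP; rewrite -absz_eq0; exact: (implyP (a0 i)).
Qed.

Lemma nexposD D k m : nexpos D (k + m) = (nexpos D k + nnodes D k m)%N.
Proof. by rewrite /nexpos /nnodes (big_cat_nat (n := k)) ?leq_addr. Qed.

Section LaurentPolynomials.
Variables (R : realType) (D : nat).
Implicit Types (L M : laurent R D) (p : 'rV[R[i]]_D) (a b : 'rV[int]_D).

Lemma explen_expo {n} (i : 'I_(nexpos D n)) : (explen (expo i) < n)%N.
Proof. by rewrite -mem_expos mem_nth // size_expos. Qed.

Lemma expoP {n a} : (explen a < n)%N -> exists i : 'I_(nexpos D n), expo i = a.
Proof.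
rewrite -mem_expos => aE.
have ia : (index a (expos D n) < nexpos D n)%N by rewrite -size_expos index_mem.
by exists (Ordinal ia); rewrite /expo nth_index.
Qed.

Lemma expo_inj n : injective (@expo D n).
Proof.
move=> i j /eqP; rewrite /expo nth_uniq ?size_expos ?expos_uniq //.
by move/eqP/val_inj.
Qed.

(** This coefficientwise form absorbs the special treatment of the zero polynomial; for [n = 0] both
    sides say that [L] vanishes. *)
Lemma longitude_ltP {L n} :
  reflect (forall a, (n <= explen a)%N -> L@_a = 0) (longitude_lt L n).
Proof.
rewrite /longitude_lt; have [->|L0] := eqVneq L 0.
  by left=> a _; rewrite mcoeff0.
apply: (iffP idP) => /= [lt_n b le_n|Ln0].
  apply/eqP; move: lt_n; apply: contraLR; rewrite mcoeff_neq0 -leqNgt => bL.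
  apply: leq_trans le_n _.
  by rewrite /longitude (bigD1_seq b) ?fset_uniq //= leq_maxl.
have [a aL] : exists a, a \in msupp L.
  apply/fset0Pn; apply: contra_neq L0 => sL; apply/malgP => a.
  by rewrite mcoeff0 mcoeff_outdom // sL.
have ltL b : b \in msupp L -> (explen b < n)%N.
  by rewrite -mcoeff_neq0; apply: contraR; rewrite -leqNgt => /Ln0->.
case: n ltL {Ln0} => [/(_ _ aL)//|n ltL]; rewrite ltnS.
by apply/bigmax_leqP_seq => b bL _; rewrite -ltnS ltL.
Qed.

Lemma longitude_lt_sum n r (c : 'I_r -> R[i]) (w : 'I_r -> laurent R D) :
  (forall i, longitude_lt (w i) n) -> longitude_lt (\sum_i c i *: w i) n.
Proof.
move=> ltw; apply/longitude_ltP => a le_n; rewrite raddf_sum big1 //= => i _.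
by rewrite mcoeffZ (longitude_ltP (ltw i)) ?mulr0.
Qed.

Lemma longitude0 : longitude (0 : laurent R D) = 0%N.
Proof. by rewrite /longitude msupp0 big_seq_fset0. Qed.

Lemma longitude_mono a : longitude (<< a >> : laurent R D) = explen a.
Proof. by rewrite /longitude msuppU oner_eq0 big_seq_fset1. Qed.

Lemma mono_neq0 a : << a >> != 0 :> laurent R D.
Proof.
by apply/eqP => /malgP/(_ a)/eqP; rewrite mcoeffU eqxx mcoeff0 oner_eq0.
Qed.

(** Enlarging the index set only adds zero terms, so the support can be traded for a list that does
    not depend on [L]. *)
Lemma mcoeff_sum_supp (s : seq 'rV[int]_D) L (F : 'rV[int]_D -> R[i]) :
    uniq s -> {subset msupp L <= s} ->
  \sum_(a <- msupp L) L@_a * F a = \sum_(a <- s) L@_a * F a.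
Proof.
move=> us sLs; rewrite [RHS](bigID (mem (msupp L))) /= [X in _ + X]big1 ?addr0.
  rewrite -[RHS]big_filter; apply: perm_big; apply: uniq_perm.
  - exact: fset_uniq.
  - exact: filter_uniq.
  - by move=> a; rewrite mem_filter; case: (boolP (a \in msupp L)) => // /sLs->.
by move=> a aL; rewrite mcoeff_outdom // mul0r.
Qed.

(** * The product of Laurent polynomials *)

Lemma mcoeff_lmul L M c :
  (lmul L M)@_c = \sum_(a <- msupp L) L@_a * M@_(c - a).
Proof.
rewrite /lmul raddf_sum; apply: eq_bigr => a _ /=; rewrite raddf_sum /=.
(* For fixed [a], only [b = c - a] can contribute to the coefficient at [c]. *)
have [caM|caM] := boolP (c - a \in msupp M).
  rewrite (bigD1_seq (c - a)) ?fset_uniq //= mcoeffU [a + _]addrC subrK eqxx.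
  rewrite big1 ?addr0 // => b nb; rewrite mcoeffU; case: eqP => // cE.
  by rewrite -cE addrAC subrr add0r eqxx in nb.
rewrite (mcoeff_outdom caM) mulr0 big_seq big1 // => b bM.
rewrite mcoeffU; case: eqP => // cE.
by rewrite -cE addrAC subrr add0r bM in caM.
Qed.

Lemma lmulC L M : lmul L M = lmul M L.
Proof.
rewrite /lmul exchange_big; apply: eq_bigr => a _; apply: eq_bigr => b _ /=.
by rewrite mulrC addrC.
Qed.

Lemma mcoeff_lmul_mono a L c : (lmul << a >> L)@_c = L@_(c - a).
Proof.
by rewrite mcoeff_lmul msuppU oner_eq0 big_seq_fset1 mcoeffU eqxx mul1r.
Qed.

(** * Consequences of niceness, and evaluation of shifts *)

Lemma longitude_const L : longitude L = 0%N -> L = << L@_0 *g 0 >>.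
Proof.
move=> L0; have /longitude_ltP Lgt0 : longitude_lt L 1.
  by rewrite /longitude_lt L0 orbT.
apply/malgP => a; rewrite mcoeffU; case: eqP => [<-//|/eqP a0].
by rewrite Lgt0 // lt0n explen_eq0 eq_sym.
Qed.

(** Since [longitude 0 = 0], niceness alone does not exclude a zero product of nonzero factors. It
    does force both factors to have longitude 0, hence to be nonzero constants, whose product is
    nonzero. *)
Lemma nice_lmul_eq0 L M : nice L -> lmul L M = 0 -> M = 0.
Proof.
case=> L0 niceL LM0; apply/eqP/negPn/negP => M0.
have /esym/eqP := niceL M M0; rewrite LM0 longitude0.
rewrite addn_eq0 => /andP[/eqP/longitude_const LE /eqP/longitude_const ME].
move/malgP/(_ 0): LM0; rewrite mcoeff0 mcoeff_lmul.
rewrite (mcoeff_sum_supp [:: 0]) //; last first.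
  by move=> a; rewrite LE msuppU; case: ifP; rewrite ?inE.
rewrite big_seq1 subrr => /eqP; rewrite mulf_eq0 => /orP[] /eqP c0.
  by rewrite LE c0 monalgU0 eqxx in L0.
by rewrite ME c0 monalgU0 eqxx in M0.
Qed.

Lemma longitude_lt_lmul L M k : nice L -> (0 < k)%N ->
  longitude_lt M k -> longitude_lt (lmul L M) (k + longitude L).
Proof.
move=> [_ niceL] k0; have [->|M0] := eqVneq M 0.
  move=> _; apply/longitude_ltP => a _; rewrite lmulC mcoeff_lmul msupp0.
  by rewrite big_seq_fset0.
by rewrite /longitude_lt (negPf M0) niceL //= addnC ltn_add2r => ->; rewrite orbT.
Qed.

(** Niceness gives the shift the exact longitude [explen a + longitude L], and the shift is nonzero.
    So the shifts allowed in the truncated ideal are exactly those with [explen a < k]. *)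
Lemma longitude_lt_lmul_mono L a k : nice L ->
  longitude_lt (lmul << a >> L) (k + longitude L) = (explen a < k)%N.
Proof.
move=> niceL; rewrite lmulC /longitude_lt niceL.2 ?mono_neq0 // longitude_mono.
rewrite addnC ltn_add2r; case: eqP => // /(nice_lmul_eq0 _ _ niceL)/eqP.
by rewrite (negPf (mono_neq0 a)).
Qed.

(** Nonzero coordinates make integer powers additive in the exponent, so [monval p] turns sums into
    products. *)
Lemma leval_lmul_mono a L p : (forall i, p ord0 i != 0) ->
  leval (lmul << a >> L) p = monval p a * leval L p.
Proof.
move=> p0; have monvalD b : monval p (a + b) = monval p a * monval p b.
  by rewrite -big_split; apply: eq_bigr => i _; rewrite mxE expfzDr.
rewrite /lmul msuppU oner_eq0 big_seq_fset1 mcoeffU eqxx /leval raddf_sum /=.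
rewrite [mmap _ _ L]/mmap mulr_sumr; apply: eq_bigr => b _.
by rewrite mmapU /= mul1r monvalD mulrCA.
Qed.

(** * Laurent polynomials of bounded longitude as coefficient rows *)

Definition coef_row n L : 'rV[R[i]]_(nexpos D n) := \row_j L@_(expo j).

Definition row_laurent n (u : 'rV[R[i]]_(nexpos D n)) : laurent R D :=
  \sum_j << u ord0 j *g expo j >>.

Lemma longitude_lt_row_laurent n u : longitude_lt (row_laurent n u) n.
Proof.
apply/longitude_ltP => a le_n; rewrite /row_laurent raddf_sum big1 //= => j _.
rewrite mcoeffU; case: eqP => // aE.
by have := explen_expo j; rewrite aE ltnNge le_n.
Qed.

Lemma mcoeff_row_laurent n u j : (row_laurent n u)@_(expo j) = u ord0 j.
Proof.
rewrite /row_laurent raddf_sum (bigD1 j) //= mcoeffU eqxx big1 ?addr0 // => i nij.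
by rewrite mcoeffU (inj_eq (@expo_inj n)) (negPf nij).
Qed.

Lemma row_laurentK n : cancel (row_laurent n) (coef_row n).
Proof. by move=> u; apply/rowP => j; rewrite mxE mcoeff_row_laurent. Qed.

Lemma coef_row_inj n L M :
  longitude_lt L n -> longitude_lt M n -> coef_row n L = coef_row n M -> L = M.
Proof.
move=> /longitude_ltP ltL /longitude_ltP ltM /rowP LM; apply/malgP => a.
have [lt_n|le_n] := ltnP (explen a) n; last by rewrite ltL // ltM.
by have [j <-] := expoP lt_n; have := LM j; rewrite !mxE.
Qed.

Lemma coef_row_sum n r (c : 'I_r -> R[i]) (w : 'I_r -> laurent R D) :
  coef_row n (\sum_i c i *: w i) = \sum_i c i *: coef_row n (w i).
Proof.
apply/rowP => j; rewrite mxE summxE raddf_sum; apply: eq_bigr => i _ /=.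
by rewrite mcoeffZ !mxE.
Qed.

Lemma longitude_lt_expand n L : longitude_lt L n -> forall F : 'rV[int]_D -> R[i],
  \sum_(a <- msupp L) L@_a * F a = \sum_(j < nexpos D n) L@_(expo j) * F (expo j).
Proof.
move=> /longitude_ltP ltL F; rewrite (mcoeff_sum_supp (expos D n)) ?expos_uniq //.
  by rewrite (big_nth 0) size_expos big_mkord.
move=> a; rewrite -mcoeff_neq0 mem_expos; apply: contraR.
by rewrite -leqNgt => /ltL->.
Qed.

Lemma leval_vandermonde n r (p : 'I_r -> 'rV[R[i]]_D) L j : longitude_lt L n ->
  leval L (p j) = (coef_row n L *m laurent_vandermonde n p) ord0 j.
Proof.
move=> ltL; rewrite /leval /mmap mxE (longitude_lt_expand _ _ ltL (monval (p j))).
by apply: eq_bigr => i _; rewrite !mxE.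
Qed.

(** A Macaulay-type matrix: multiplication by [L] in the monomial bases, acting on rows.
    Coefficients at exponents of length at least [n] are cut off; for nice [L] and
    [n = k + longitude L] nothing is lost. *)
Definition translates L k n : 'M[R[i]]_(nexpos D k, nexpos D n) :=
  \matrix_i coef_row n (lmul << expo i >> L).

Lemma mulmx_translates L k n u :
  u *m translates L k n = coef_row n (lmul L (row_laurent k u)).
Proof.
apply/rowP => j; rewrite !mxE lmulC mcoeff_lmul.
rewrite (longitude_lt_expand _ _ (longitude_lt_row_laurent k u) (fun a => L@_(_ - a))).
by apply: eq_bigr => i _; rewrite !mxE mcoeff_lmul_mono mcoeff_row_laurent.
Qed.

(** The rows are independent: a row in the left kernel encodes some [M] for which [lmul L M] has no
    coefficient below the bound, and its longitude allows none above. Hence the product is 0, and so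
    is [M]. *)
Lemma rank_translates L k : nice L -> (0 < k)%N ->
  \rank (translates L k (k + longitude L)) = nexpos D k.
Proof.
move=> niceL k0; apply/eqP; rewrite -/(row_free _) -kermx_eq0.
apply/rowV0P => u /sub_kermxP; rewrite mulmx_translates => uA0.
have LM0 : lmul L (row_laurent k u) = 0.
  apply: (coef_row_inj (k + longitude L)).
  - exact/longitude_lt_lmul/longitude_lt_row_laurent.
  - by rewrite /longitude_lt eqxx.
  - by rewrite uA0; apply/rowP => j; rewrite !mxE mcoeff0.
rewrite -[u]row_laurentK (nice_lmul_eq0 _ _ niceL LM0).
by apply/rowP => j; rewrite !mxE mcoeff0.
Qed.

(** * The ideal and the orthogonal complement as row spaces *)

Lemma trunc_idealP L k M : nice L ->
  trunc_ideal L (k + longitude L) M <->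
  longitude_lt M (k + longitude L) /\
  (coef_row _ M <= translates L k (k + longitude L))%MS.
Proof.
set n := (k + _)%N => niceL; split=> [[r [c [w [wL ->]]]]|[ltM /submxP[u uM]]].
  split; first by apply: longitude_lt_sum => i; case: (wL i).
  rewrite coef_row_sum; apply: summx_sub => i _; apply: scalemx_sub.
  (* A generator is a shift by an arbitrary [a]; its longitude bound forces [explen a < k], which
     makes it a row of [translates]. *)
  have [lt_n [a wE]] := wL i; move: lt_n; rewrite wE longitude_lt_lmul_mono //.
  case/expoP => j <-; rewrite (_ : coef_row _ _ = row j (translates L k n)) ?row_sub //.
  by rewrite rowK.
have ltw (i : 'I_(nexpos D k)) : longitude_lt (lmul << expo i >> L) n.
  by rewrite longitude_lt_lmul_mono // explen_expo.
exists (nexpos D k), (u ord0), (fun i => lmul << expo i >> L); split.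
  by move=> i; split=> //; exists (expo i).
apply: (coef_row_inj n) => //; first exact: longitude_lt_sum.
by rewrite uM mulmx_sum_row coef_row_sum; apply: eq_bigr => i _; rewrite rowK.
Qed.

(** The conjugations in [orth_im] and [laurent_of] cancel, so the complement becomes the left kernel
    [kermx] of the Vandermonde matrix, on unconjugated coefficient rows. *)
Lemma vanishingP n r (p : 'I_r -> 'rV[R[i]]_D) M :
  [set laurent_of v | v in orth_im (laurent_vandermonde n p)] M <->
  longitude_lt M n /\ (coef_row n M <= kermx (laurent_vandermonde n p))%MS.
Proof.
rewrite orth_im_laurent; split=> -[ltM Mp]; split=> //.
  apply/sub_kermxP/rowP => j.
  by rewrite -leval_vandermonde // Mp mxE.
by move=> j; rewrite (leval_vandermonde n) // (sub_kermxP Mp) mxE.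
Qed.

Lemma translates_sub_ker L k r (p : 'I_r -> 'rV[R[i]]_D) : nice L ->
    (forall j, zeros L (p j)) ->
  (translates L k (k + longitude L)
     <= kermx (laurent_vandermonde (k + longitude L) p))%MS.
Proof.
move=> niceL Lp; apply/row_subP => i; rewrite rowK; apply/sub_kermxP/rowP => j.
rewrite -leval_vandermonde ?longitude_lt_lmul_mono ?explen_expo //.
by have [p0 Lpj] := Lp j; rewrite leval_lmul_mono // Lpj mulr0 mxE.
Qed.

End LaurentPolynomials.

Theorem theorem3p2 (R : realType) (D : nat) (L : laurent R D) (hL : nice L)
    (m : nat) (hm : m = longitude L) (k : nat) (hk : (1 <= k)%N)
    (p : 'I_(nnodes D k m) -> 'rV[R[i]]_D) (hp : forall j, zeros L (p j)) :
  \rank (laurent_vandermonde (k + m) p) = nnodes D k m <->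
  trunc_ideal L (k + m) =
    [set laurent_of v | v in orth_im (laurent_vandermonde (k + m) p)].
Proof.
subst m; set n := (k + _)%N; set V := laurent_vandermonde n p.
have sAK := translates_sub_ker _ _ _ k _ p hL hp.
have rA := rank_translates _ _ _ k hL hk.
have rV : (\rank V <= nnodes D k (longitude L))%N by exact: rank_leq_col.
(* As the row space of [translates] lies in the kernel, the reverse inclusion is the inequality
   [nexpos D n - \rank V <= nexpos D k]. By [nexposD] this is [nnodes D k (longitude L) <= \rank V],
   and [rV] is the opposite bound. *)
have dimE : (\rank V = nnodes D k (longitude L)) <->
    (kermx V <= translates _ _ L k n)%MS.
  rewrite -(geq_leqif (mxrank_leqif_sup sAK)) mxrank_ker rA leq_subLR.
  rewrite [X in (X <= _)%N]nexposD [X in (X <= _)%N]addnC leq_add2r.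
  by split=> [->//|leV]; apply/eqP; rewrite eqn_leq rV.
rewrite dimE; split=> [sKA|AV].
  apply/seteqP; split=> M.
    case/trunc_idealP=> // ltM MA; apply/vanishingP; split=> //.
    exact: submx_trans sAK.
  case/vanishingP=> ltM MK; apply/trunc_idealP => //; split=> //.
  exact: submx_trans sKA.
(* The equality of sets of polynomials is carried back to matrices by reading each kernel row as a
   polynomial. *)
apply/rV_subP => u uK.
have : trunc_ideal L n (row_laurent _ _ n u).
  rewrite AV; apply/vanishingP; split; first exact: longitude_lt_row_laurent.
  by rewrite row_laurentK.
by case/trunc_idealP => // _; rewrite row_laurentK.
Qed.
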